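(* For coherence spaces $A,B$ and a linear morphism $\ell:A\to B$ (identified with its trace $\ell\subset|A|\times|B|$), let $$\mathrm{flag}\,\ell=\{(f,g)\in|\mathrm{flag}\,A|\times|\mathrm{flag}\,B| \mid \forall w\in 2^{\omega}\ (f(w),g(w))\in\ell\}.$$ Then $\mathrm{flag}\,\ell$ is the trace of a linear morphism $\mathrm{flag}\,A\to\mathrm{flag}\,B$, and the assignments $A\mapsto\mathrm{flag}\,A$, $\ell\mapsto\mathrm{flag}\,\ell$ define an endofunctor of the category $\mathbf{Coh}$ of coherence spaces and linear morphisms.
   Context: A coherence space $A$ is a set $|A|$ (its web, possibly infinite, whose elements are called tokens) endowed with a reflexive and symmetric binary relation on $|A|$, called coherence and written $\alpha\sim\alpha'\,[A]$. Strict coherence $\alpha\frown\alpha'\,[A]$ means $\alpha\sim\alpha'\,[A]$ and $\alpha\neq\alpha'$. A clique of $A$ is a set of pairwise coherent tokens. Linear morphisms from $A$ to $B$ are maps $F$ from cliques of $A$ to cliques of $B$ that are monotone for inclusion, commute with unions of families of pairwise compatible cliques (two cliques being compatible when their union is a clique), and satisfy $F(x\cap x')=F(x)\cap F(x')$ whenever $x\cup x'$ is a clique. They are in one-to-one correspondence with their traces $\{(\alpha,\beta)\mid \beta\in F(\{\alpha\})\}\subset|A|\times|B|$, which are exactly the cliques of the coherence space $A\multimap B$ with web $|A|\times|B|$ in which $(\alpha,\beta)\sim(\alpha',\beta')$ iff: ($\alpha\sim\alpha'\,[A]$ implies $\beta\sim\beta'\,[B]$) and ($\alpha\frown\alpha'\,[A]$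 implies $\beta\frown\beta'\,[B]$). Composition of linear morphisms corresponds to relational composition of traces, and the identity has trace $\{(\alpha,\alpha)\mid\alpha\in|A|\}$. $\mathbf{Coh}$ is the category of coherence spaces and linear morphisms. Let $2^{\omega}$ be the set of infinite words on $\{0,1\}$, with the product topology (Cantor space) and the lexicographic total order: $w_1<w_2$ iff there are a finite word $m$ and infinite words $w_1',w_2'$ with $w_1=m0w_1'$ and $w_2=m1w_2'$. For a coherence space $A$, the coherence space $\mathrm{flag}\,A$ is defined as follows. Its web is the set of continuous functions from $2^\omega$ to $|A|$, where $|A|$ has the discrete topology. Two functions $f,g$ in this web are strictly coherent, $f\frown g\,[\mathrm{flag}\,A]$, iff there exists $w\in 2^\omega$ such that $f(w)\frown g(w)\,[A]$ and $f(w')=g(w')$ for all $w'<w$. *)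

(* Defs.v *)
From mathcomp Require Import all_boot all_classical topology cantor.

Set Implicit Arguments.
Unset Strict Implicit.
Unset Printing Implicit Defensive.

Local Open Scope classical_set_scope.

Record category := Category {
  obj :> Type;
  hom : obj -> obj -> Type;
  idmap : forall A, hom A A;
  compose : forall A B C, hom B C -> hom A B -> hom A C;
  comp_id_l : forall A B (f : hom A B), compose (idmap B) f = f;
  comp_id_r : forall A B (f : hom A B), compose f (idmap A) = f;
  compA : forall A B C D (h : hom C D) (g : hom B C) (f : hom A B),
    compose h (compose g f) = compose (compose h g) f }.

Arguments idmap {c} A.
Arguments compose {c A B C} g f.

Definition is_functor (C D : category) (Fo : C -> D)
    (Fm : forall A B : C, hom A B -> hom (Fo A) (Fo B)) : Prop :=
  (forall A : C, Fm A A (idmap A) = idmap (Fo A)) /\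
  (forall (A B E : C) (g : hom B E) (f : hom A B),
    Fm A E (compose g f) = compose (Fm B E g) (Fm A B f)).

Record cohSpace := CohSpace {
  web : Type;
  coh : web -> web -> Prop;
  coh_refl : forall a, coh a a;
  coh_sym : forall a b, coh a b -> coh b a }.

Arguments coh : clear implicits.
Arguments coh_refl : clear implicits.

Definition scoh (A : cohSpace) (a b : web A) : Prop := coh A a b /\ a <> b.
Arguments scoh : clear implicits.

Definition is_clique (A : cohSpace) (x : set (web A)) : Prop :=
  forall a b, x a -> x b -> coh A a b.
Arguments is_clique : clear implicits.

Record clique (A : cohSpace) := Clique {
  tokens :> set (web A);
  cliqueP : is_clique A tokens }.

Definition compatible (A : cohSpace) (x y : clique A) : Prop :=
  is_clique A (x `|` y).

Lemma clique_eq (A : cohSpace) (x y : clique A) :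
  x = y :> set (web A) -> x = y.
Proof.
by case: x y => [x xP] [y yP] /= exy; subst y; congr Clique; exact: Prop_irrelevance.
Qed.

Lemma is_clique1 (A : cohSpace) (a : web A) : is_clique A [set a].
Proof. by move=> _ _ -> ->; exact: coh_refl. Qed.

Definition clique1 (A : cohSpace) (a : web A) : clique A :=
  Clique (@is_clique1 A a).

Lemma is_cliqueI (A : cohSpace) (x y : clique A) : is_clique A (x `&` y).
Proof. by move=> a b [xa _] [xb _]; exact: (cliqueP xa xb). Qed.

Definition cliqueI (A : cohSpace) (x y : clique A) : clique A :=
  Clique (@is_cliqueI A x y).

Definition pairwise_compatible (A : cohSpace) (X : set (clique A)) : Prop :=
  forall x y, X x -> X y -> compatible x y.

Lemma is_clique_union (A : cohSpace) (X : set (clique A)) :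
  pairwise_compatible X -> is_clique A (\bigcup_(x in X) (x : set (web A))).
Proof.
move=> cX a b [x Xx xa] [y Xy yb].
by apply: (cX x y Xx Xy); [left | right].
Qed.

Definition clique_union (A : cohSpace) (X : set (clique A))
    (cX : pairwise_compatible X) : clique A :=
  Clique (is_clique_union cX).

(* A family of cliques is given by the set of its members; it may be empty,
   so that linear maps preserve the empty clique. *)
Record linear (A B : cohSpace) := Linear {
  lfun :> clique A -> clique B;
  lin_mono : forall x y : clique A,
    (x : set (web A)) `<=` y -> (lfun x : set (web B)) `<=` lfun y;
  lin_union : forall (X : set (clique A)) (cX : pairwise_compatible X),
    (lfun (clique_union cX) : set (web B)) =
      \bigcup_(x in X) (lfun x : set (web B));
  lin_inter : forall x y : clique A, compatible x y ->
    (lfun (cliqueI x y) : set (web B)) = lfun x `&` lfun y }.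

Lemma linear_eq (A B : cohSpace) (F G : linear A B) : lfun F = lfun G -> F = G.
Proof.
case: F G => [F F1 F2 F3] [G G1 G2 G3] /= eFG; subst G.
by congr Linear; exact: Prop_irrelevance.
Qed.

Lemma lin_compatible (A B : cohSpace) (F : linear A B) (x y : clique A) :
  compatible x y -> compatible (F x) (F y).
Proof.
move=> cxy b b' Fb Fb'; pose u := Clique cxy.
have sub (z : clique A) : (z : set (web A)) `<=` u ->
    (F z : set (web B)) `<=` F u by exact: lin_mono.
by apply: (@cliqueP _ (F u)); [case: Fb | case: Fb'] => /sub; apply=> ? ?;
  by [left | right].
Qed.

Definition linear_id (A : cohSpace) : linear A A.
Proof. by exists id. Defined.

Definition linear_comp (A B C : cohSpace) (G : linear B C) (F : linear A B) :
  linear A C.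
Proof.
exists (G \o F).
- by move=> x y xy; do 2![apply: lin_mono].
- move=> X cX /=.
  have cFX : pairwise_compatible [set F x | x in X].
    by move=> _ _ [x Xx <-] [y Xy <-]; apply: lin_compatible; exact: cX.
  have -> : F (clique_union cX) = clique_union cFX.
    by apply: clique_eq; rewrite lin_union /= bigcup_image.
  by rewrite lin_union bigcup_image.
- move=> x y cxy /=.
  have -> : F (cliqueI x y) = cliqueI (F x) (F y).
    by apply: clique_eq; rewrite lin_inter.
  by rewrite lin_inter //; exact: lin_compatible.
Defined.

Definition Coh : category.
Proof.
by refine (@Category cohSpace linear linear_id linear_comp _ _ _) => *;
  exact: linear_eq.
Defined.

Definition trace (A B : cohSpace) (F : linear A B) : set (web A * web B) :=
  [set ab | (F (clique1 ab.1) : set (web B)) ab.2].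

Lemma trace_inj (A B : cohSpace) : injective (@trace A B).
Proof.
move=> F G eFG; apply: linear_eq; apply: funext => x.
have cX : pairwise_compatible [set clique1 a | a in (x : set (web A))].
  move=> _ _ [a xa <-] [b xb <-] c d cab dab.
  by apply: (@cliqueP _ x); [case: cab | case: dab] => ->.
have -> : x = clique_union cX.
  by apply: clique_eq; rewrite /= bigcup_image /= bigcup_imset1 image_id.
apply: clique_eq; rewrite !lin_union !bigcup_image; apply: eq_bigcupr => a _.
apply/seteqP; split=> b; have := congr1 (fun T => T (a, b)) eFG;
  by rewrite /trace /= => ->.
Qed.

Definition word_cat (m : seq bool) (w : cantor_space) : cantor_space :=
  fun n => if n < size m then nth false m n else w (n - size m).

Definition lex_lt (w1 w2 : cantor_space) : Prop :=
  exists (m : seq bool) (w1' w2' : cantor_space),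
    w1 = word_cat (rcons m false) w1' /\ w2 = word_cat (rcons m true) w2'.

(* {classic _} only supplies the choice structure that the discrete topology
   requires of its carrier. *)
Definition flag_web (A : cohSpace) : Type :=
  continuousType cantor_space (discrete_topology {classic (web A)}).

Definition flag_scoh (A : cohSpace) (f g : flag_web A) : Prop :=
  exists w : cantor_space,
    scoh A (f w) (g w) /\ forall w', lex_lt w' w -> f w' = g w'.

Definition flag_coh (A : cohSpace) (f g : flag_web A) : Prop :=
  f = g \/ flag_scoh f g.

Lemma flag_coh_refl (A : cohSpace) (f : flag_web A) : flag_coh f f.
Proof. by left. Qed.

Lemma flag_coh_sym (A : cohSpace) (f g : flag_web A) :
  flag_coh f g -> flag_coh g f.
Proof.
case=> [->|[w [[fg nfg] eq_fg]]]; first by left.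
right; exists w; split; last by move=> w' /eq_fg.
by split; [exact: coh_sym | move=> /esym].
Qed.

Definition flag (A : cohSpace) : cohSpace :=
  CohSpace (@flag_coh_refl A) (@flag_coh_sym A).

Lemma flag_scohE (A : cohSpace) (f g : web (flag A)) :
  scoh (flag A) f g <-> flag_scoh f g.
Proof.
split=> [[[//|//]]|fg]; split; first by right.
by case: fg => w [[_ nfg] _] efg; apply: nfg; rewrite efg.
Qed.

Definition flag_rel (A B : cohSpace) (l : set (web A * web B)) :
    set (web (flag A) * web (flag B)) :=
  [set fg : flag_web A * flag_web B |
    forall w : cantor_space, l (fg.1 w, fg.2 w)].

(* Main.v *)
(* Both claims are about traces. Two continuous functions with values in a
   discrete space disagree on a closed set, and a nonempty closed subset of the
   Cantor space has a lexicographic minimum. Comparing the first disagreement of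
   two outputs g, g' with the position witnessing the coherence of the inputs
   f, f' shows that flag l is a clique of flag A -o flag B. For composition, the
   intermediate function is obtained by choosing a token of B as a function of
   the pair (f w, h w), which makes it locally constant. *)
From mathcomp Require Import all_boot all_classical topology function_spaces.
From mathcomp Require Import cantor.
Require Import Defs.

Set Implicit Arguments.
Unset Strict Implicit.
Unset Printing Implicit Defensive.

Local Open Scope classical_set_scope.

(** * Linear morphisms and their traces *)

(* [T] is a clique of the coherence space A -o B. *)
Definition is_trace (A B : cohSpace) (T : set (web A * web B)) : Prop :=
  forall a b a' b', T (a, b) -> T (a', b') -> coh A a a' ->
    coh B b b' /\ (b = b' -> a = a').

Definition rel_image (A B : cohSpace) (T : set (web A * web B))
    (x : set (web A)) : set (web B) := [set b | exists2 a, x a & T (a, b)].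

Lemma is_clique_rel_image (A B : cohSpace) (T : set (web A * web B))
    (trT : is_trace T) (x : clique A) : is_clique B (rel_image T x).
Proof.
move=> b b' [a xa ab] [a' xa' ab'].
by case: (trT _ _ _ _ ab ab' (cliqueP xa xa')).
Qed.

Definition rel_linear (A B : cohSpace) (T : set (web A * web B))
  (trT : is_trace T) : linear A B.
Proof.
exists (fun x => Clique (@is_clique_rel_image A B T trT x)).
- by move=> x y xy b /= [a /xy ya ab]; exists a.
- move=> X cX; apply/seteqP; split=> b /=.
    by case=> a [x Xx xa] ab; exists x => //; exists a.
  by case=> x Xx [a xa ab]; exists a => //; exists x.
- move=> x y cxy; apply/seteqP; split=> b /=.
    by case=> a [xa ya] ab; split; exists a.
  case=> -[a xa ab] [a' ya' ab'].
  (* The tokens [a] and [a'] yield the same [b] and are coherent because [x] and [y] are compatible,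
     so they coincide and lie in the intersection. *)
  have [|_ /(_ erefl) eaa'] := trT _ _ _ _ ab ab'.
    by apply: cxy; [left | right].
  by exists a => //; split=> //; rewrite eaa'.
Defined.

Lemma trace_rel_linear (A B : cohSpace) (T : set (web A * web B))
    (trT : is_trace T) : trace (rel_linear trT) = T.
Proof.
apply/seteqP; split=> -[a b]; first by case=> _ /= ->.
by move=> ab; exists a.
Qed.

(** If distinct coherent tokens yielded a common [b], preservation of intersections would put [b] in
    the image of the empty clique, which is empty because [l] preserves the empty union. *)
Lemma trace_is_trace (A B : cohSpace) (l : linear A B) : is_trace (trace l).
Proof.
move=> a b a' b' /= lab lab' caa'.
have cpt : compatible (clique1 a) (clique1 a').
  move=> c d [->|->] [->|->] //; [exact: coh_refl | | exact: coh_refl].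
  exact: coh_sym.
split; first by apply: (@lin_compatible _ _ l _ _ cpt); [left | right].
move=> ebb'; apply: contrapT => naa'.
have no_member : @pairwise_compatible A set0 by move=> x y [].
have : tokens (l (cliqueI (clique1 a) (clique1 a'))) b.
  by rewrite lin_inter //; split=> //; rewrite ebb'.
have -> : cliqueI (clique1 a) (clique1 a') = clique_union no_member.
  apply: clique_eq; rewrite /= bigcup_set0.
  by apply/seteqP; split=> c [] // -> /= /naa'.
by rewrite lin_union bigcup_set0.
Qed.

(** A clique is the union of the singletons of its tokens, and [l] commutes with this union. *)
Lemma lin_tokens (A B : cohSpace) (l : linear A B) (x : clique A) (b : web B) :
  tokens (l x) b <-> exists2 a, tokens x a & trace l (a, b).
Proof.
split=> [lxb|[a xa]]; last by apply: lin_mono => _ ->.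
have cX : pairwise_compatible [set clique1 a | a in tokens x].
  move=> _ _ [a xa <-] [a' xa' <-] c d cc dd.
  by apply: (@cliqueP _ x); [case: cc | case: dd] => ->.
have ex : x = clique_union cX.
  by apply: clique_eq; rewrite /= bigcup_image /= bigcup_imset1 image_id.
by move: lxb; rewrite [x in l x]ex lin_union bigcup_image.
Qed.

Lemma trace_id (A : cohSpace) : trace (linear_id A) = [set aa | aa.2 = aa.1].
Proof. by []. Qed.

Lemma trace_comp (A B C : cohSpace) (m : linear B C) (l : linear A B) :
  trace (linear_comp m l) =
    [set ac | exists2 b, trace l (ac.1, b) & trace m (b, ac.2)].
Proof.
by apply/seteqP; split=> -[a c]; case: (lin_tokens m (l (clique1 a)) c).
Qed.

(** * Lexicographic order and closed sets of words *)

Lemma lex_lt_prefix (v w : cantor_space) :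
  lex_lt v w <->
  exists n, [/\ forall i, i < n -> v i = w i, v n = false & w n = true].
Proof.
split=> [[m [v' [w' [-> ->]]]]|[n [evw vn wn]]].
  exists (size m); split=> [i im||]; rewrite /word_cat !size_rcons ?ltnS.
  - by rewrite (ltnW im) !nth_rcons im.
  - by rewrite leqnn nth_rcons ltnn eqxx.
  - by rewrite leqnn nth_rcons ltnn eqxx.
have catE (u : cantor_space) (b : bool) : u n = b ->
    u = word_cat (rcons (mkseq u n) b) (fun i => u (i + n.+1)).
  move=> un; apply: funext => i.
  rewrite /word_cat size_rcons size_mkseq ltnS; case: ltngtP => [ilt|igt|->].
  - by rewrite nth_rcons size_mkseq ilt nth_mkseq.
  - by rewrite subnK.
  - by rewrite nth_rcons size_mkseq ltnn eqxx.
exists (mkseq v n), (fun i => v (i + n.+1)), (fun i => w (i + n.+1)).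
split; first exact: catE.
have -> : mkseq v n = mkseq w n.
  by apply/eq_in_map => i; rewrite mem_iota /= => /evw.
exact: catE.
Qed.

Lemma lex_lt_total (v w : cantor_space) : [\/ v = w, lex_lt v w | lex_lt w v].
Proof.
have [->|nvw] := pselect (v = w); first by constructor 1.
have exn : exists n, v n != w n.
  apply: contrapT => nex; apply: nvw; apply: funext => n.
  by apply: contrapT => /eqP nvwn; apply: nex; exists n.
case: (ex_minnP exn) => n nvwn minn.
have evw i : i < n -> v i = w i.
  by move=> iltn; apply/eqP; apply: contraLR iltn; rewrite -leqNgt => /minn.
case vn: (v n) nvwn; case wn: (w n) => // _; [constructor 3 | constructor 2];
  by apply/lex_lt_prefix; exists n; split=> // i /evw.
Qed.

(** The chosen [v n] converge to [w] letter by letter, which is convergence in the product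
    topology. *)
Lemma closed_cantor_prefix (D : set cantor_space) (w : cantor_space) :
  closed D ->
  (forall n, exists v, D v /\ forall i, i < n -> v i = w i) -> D w.
Proof.
move=> clD /choice [v Dv].
apply: (@closed_cvg _ _ \oo _ v D) => //.
  by apply: nearW => n; exact: (Dv n).1.
apply/pointwise_cvgP => i; apply: cvg_near_cst.
have vi n : i < n -> v n i = w i by exact: (Dv n).2.
exact: filterS vi (nbhs_infty_gt i).
Qed.

(* The prefixes of the lexicographic minimum of [D], if it is closed and
   nonempty. *)
Fixpoint greedy_prefix (D : set cantor_space) (n : nat) : seq bool :=
  if n isn't k.+1 then [::] else
  let p := greedy_prefix D k in
  rcons p (~~ `[< exists v, [/\ D v, mkseq v k = p & v k = false] >]).

Lemma size_greedy_prefix (D : set cantor_space) (n : nat) :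
  size (greedy_prefix D n) = n.
Proof. by elim: n => //= n IHn; rewrite size_rcons IHn. Qed.

(** Every prefix of the greedy word [w] extends to a member of [D], so [w] is in [D] by closedness.
    A smaller [v] first differs from [w] by a 0 where no member of [D] sharing that prefix has
    one. *)
Lemma closed_lex_min (D : set cantor_space) :
  closed D -> D !=set0 -> exists2 w, D w & forall v, lex_lt v w -> ~ D v.
Proof.
move=> clD [u Du].
pose w : cantor_space := fun n => nth false (greedy_prefix D n.+1) n.
have mkseqw n : mkseq w n = greedy_prefix D n.
  elim: n => // n IHn; rewrite mkseqS IHn /w /= nth_rcons size_greedy_prefix.
  by rewrite ltnn eqxx.
have wE n :
    w n = ~~ `[< exists v, [/\ D v, mkseq v n = mkseq w n & v n = false] >].
  by rewrite mkseqw /w /= nth_rcons size_greedy_prefix ltnn eqxx.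
have mkseq_eq (v : cantor_space) n :
    mkseq v n = mkseq w n <-> forall i, i < n -> v i = w i.
  split=> [evw i iltn|evw].
    by rewrite -(nth_mkseq false v iltn) evw nth_mkseq.
  by apply/eq_in_map => i; rewrite mem_iota /= => /evw.
exists w.
  apply: closed_cantor_prefix => // n.
  suff [v [Dv /mkseq_eq evw]] : exists v, D v /\ mkseq v n = mkseq w n.
    by exists v.
  elim: n => [|n [v [Dv evw]]]; first by exists u.
  have [|] := pselect (exists v, [/\ D v, mkseq v n = mkseq w n & v n = false]).
    move=> ex; have [v' [Dv' ev'w v'n]] := ex; exists v'; split=> //.
    by rewrite !mkseqS ev'w v'n wE asboolT.
  (* No member continues the prefix with 0, so the current witness continues it with 1, as [w]
     does. *)
  move=> nex; exists v; split=> //; rewrite !mkseqS evw wE asboolF //=.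
  by case vn: (v n) => //; case: nex; exists v.
move=> v /lex_lt_prefix [n [/mkseq_eq evw vn]].
by rewrite wE => /negbTE /asboolPn nex Dv; apply: nex; exists v.
Qed.

(** * Continuous functions with discrete values *)

Lemma discrete_cts (T : topologicalType) (X : choiceType)
    (f : T -> discrete_topology X) :
  continuous f <-> forall x, \forall y \near x, f y = f x.
Proof.
split=> cf x; last exact: (cvg_near_cst (f x) (cf x)).
exact: (cf x _ (discrete_set1 (f x))).
Qed.

Lemma closed_neq (T : topologicalType) (X : choiceType)
    (f g : continuousType T (discrete_topology X)) :
  closed [set x | f x <> g x].
Proof.
have /discrete_cts cf := @cts_fun _ _ f.
have /discrete_cts cg := @cts_fun _ _ g.
have -> : [set x | f x <> g x] = ~` [set x | f x = g x] by [].
apply: open_closedC; rewrite openE => x /= efg.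
by apply: filterS2 (cf x) (cg x) => y /= -> ->.
Qed.

Lemma flag_neq (A : cohSpace) (f g : flag_web A) : f <> g ->
  exists w, f w <> g w /\ forall v, lex_lt v w -> f v = g v.
Proof.
move=> nfg; have [|w fgw minw] := closed_lex_min (@closed_neq _ _ f g).
  apply: contrapT => /forallNP efg; apply: nfg; apply/continuousEP => w.
  by apply: contrapT; exact: efg.
by exists w; split=> // v /minw /contrapT.
Qed.

(** * Functoriality of [flag] *)

Lemma flag_rel_is_trace (A B : cohSpace) (T : set (web A * web B)) :
  is_trace T -> is_trace (flag_rel T).
Proof.
move=> trT f g f' g' /= Tfg Tf'g' cff'.
have {}trT w := trT _ _ _ _ (Tfg w) (Tf'g' w).
have [egg'|/flag_neq [w [ngg' egg']]] := pselect (g = g').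
  split=> [|_]; first by left.
  case: cff' => // -[w [[cw nw] _]].
  (* Equal outputs at [w] force equal inputs there, against strict coherence. *)
  by case: nw; apply: (trT w cw).2; rewrite /= egg'.
split; last by move=> eqgg'; case: ngg'; rewrite eqgg'.
right; exists w; split=> //; split=> //.
suff cw : coh A (f w) (f' w) by exact: (trT w cw).1.
case: cff' => [->|[v [[cv nv] eff']]]; first exact: coh_refl.
(* Before [v] the inputs agree. If [v] came before [w], the outputs would agree at [v], hence the
   inputs too, which is excluded. *)
have [->//|ltwv|ltvw] := lex_lt_total w v.
  by rewrite eff' //; exact: coh_refl.
by case: nv; apply: (trT v cv).2; exact: egg'.
Qed.

Definition flag_map (A B : cohSpace) (l : linear A B) :
    linear (flag A) (flag B) :=
  rel_linear (flag_rel_is_trace (@trace_is_trace A B l)).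

Lemma trace_flag_map (A B : cohSpace) (l : linear A B) :
  trace (flag_map l) = flag_rel (trace l).
Proof. exact: trace_rel_linear. Qed.

Lemma flag_map_id (A : cohSpace) : flag_map (linear_id A) = linear_id (flag A).
Proof.
apply: trace_inj; rewrite trace_flag_map !trace_id.
apply/seteqP; split=> -[f g]; last by move=> /= -> w.
by move=> efg; apply/continuousEP.
Qed.

Lemma flag_rel_comp (A B C : cohSpace) (S : set (web A * web B))
    (T : set (web B * web C)) :
  flag_rel [set ac | exists2 b, S (ac.1, b) & T (b, ac.2)] =
    [set fh | exists2 g, flag_rel S (fh.1, g) & flag_rel T (g, fh.2)].
Proof.
apply/seteqP; split=> -[f h] /=; last first.
  by case=> g Sfg Tgh w; exists (g w); [exact: Sfg | exact: Tgh].
move=> STfh.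
have /choice [c cP] : forall ac : web A * web C, exists b : web B,
    (exists2 b', S (ac.1, b') & T (b', ac.2)) -> S (ac.1, b) /\ T (b, ac.2).
  move=> [a c].
  have [[b Sb Tb]|nex] := pselect (exists2 b, S (a, b) & T (b, c)).
    by exists b.
  (* The default token is the one that [STfh] provides at an arbitrary word. *)
  by have [b0 _ _] := STfh (fun=> false); exists b0 => /nex.
have /discrete_cts cf := @cts_fun _ _ f.
have /discrete_cts ch := @cts_fun _ _ h.
pose g (w : cantor_space) : discrete_topology {classic (web B)} := c (f w, h w).
have cg : continuous g.
  apply/discrete_cts => w; apply: filterS2 (cf w) (ch w) => v fv hv.
  by rewrite /g fv hv.
by exists (mkcts cg) => w; have [] := cP (f w, h w) (STfh w).
Qed.

Theorem proposition19 :
  exists flag_map :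
      forall A B : cohSpace, linear A B -> linear (flag A) (flag B),
    (forall (A B : cohSpace) (l : linear A B),
       trace (flag_map A B l) = flag_rel (trace l)) /\
    @is_functor Coh Coh flag flag_map.
Proof.
exists flag_map; split; first exact: trace_flag_map.
split; first exact: flag_map_id.
(* A linear morphism is determined by its trace, so relational composites are compared. *)
move=> A B E m l; apply: trace_inj.
by rewrite trace_flag_map !trace_comp !trace_flag_map flag_rel_comp.
Qed.
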